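(* Let $\Gamma$ be a finite connected tetravalent graph and let $G\le \mathrm{Aut}(\Gamma)$ be such that $\Gamma$ is $(G,\frac12)$-arc-transitive. If $G$ contains an abelian normal subgroup $N$ such that $N_v\neq 1$ for some vertex $v$ of $\Gamma$, then $G$ is solvable and the vertex-stabiliser $G_v$ is elementary abelian.
   Context: A graph is a quadruple $(D,V;\mathrm{beg},\mathrm{inv})$ where $D$ (darts) and $V\neq\emptyset$ (vertices) are disjoint finite sets, $\mathrm{beg}\colon D\to V$ assigns to each dart its initial vertex, and $\mathrm{inv}\colon D\to D$ is an involution (possibly with fixed points). Edges are the orbits of $\mathrm{inv}$ (so loops, parallel edges and semiedges, i.e. darts fixed by $\mathrm{inv}$, are allowed). The valence of a vertex $v$ is the number of darts $x$ with $\mathrm{beg}(x)=v$; tetravalent means all vertices have valence $4$. An automorphism is a bijection of $V\cup D$ mapping $V$ to $V$, $D$ to $D$, and commuting with $\mathrm{beg}$ and $\mathrm{inv}$. For $G\le\mathrm{Aut}(\Gamma)$, the connected graph $\Gamma$ is $(G,\frac12)$-arc-transitive if $G$ acts transitively on the vertices and on the edges of $\Gamma$ but not on its darts. $N_v$ denotes the stabiliser of $v$ in $N$. *)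

(* Defs.v *)
From HB Require Import structures.
From mathcomp Require Import all_boot all_fingroup all_solvable.

Set Implicit Arguments.
Unset Strict Implicit.
Unset Printing Implicit Defensive.

Import GroupScope.

Record dgraph := DGraph {
  vertex : finType;
  dart : finType;
  beg : dart -> vertex;
  inv : dart -> dart;
  inv_involutive : involutive inv;
  vertex_nonempty : 0 < #|vertex|
}.

(* The disjoint union of the vertices and the darts, on which automorphisms
   act by the natural action 'P of permutations. *)
Definition cell (X : dgraph) : finType := (vertex X + dart X)%type.

Section Graph.

Variable X : dgraph.

Definition vcell (v : vertex X) : cell X := inl v.
Definition dcell (x : dart X) : cell X := inr x.

Definition vertices : {set cell X} := [set vcell v | v : vertex X].
Definition darts : {set cell X} := [set dcell x | x : dart X].

Definition edge (x : dart X) : {set cell X} :=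
  [set dcell y | y in fingraph.orbit (@inv X) x].
Definition edges : {set {set cell X}} := [set edge x | x : dart X].

Definition valence (v : vertex X) : nat := #|[set x : dart X | beg x == v]|.
Definition tetravalent : Prop := forall v : vertex X, valence v = 4.

Definition adjacent : rel (vertex X) :=
  [rel u v | [exists x : dart X, (beg x == u) && (beg (inv x) == v)]].
Definition connected : Prop := forall u v : vertex X, connect adjacent u v.

(* beg and inv, extended by the identity on vertices: a permutation that
   preserves vertices and darts commutes with the extensions iff it commutes
   with beg and inv on darts. *)
Definition cbeg (a : cell X) : cell X :=
  match a with inl v => vcell v | inr x => vcell (beg x) end.
Definition cinv (a : cell X) : cell X :=
  match a with inl v => vcell v | inr x => dcell (inv x) end.

Definition gaut : {set {perm cell X}} :=
  [set s : {perm cell X} | [&& s @: vertices == vertices, s @: darts == darts,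
     [forall a, s (cbeg a) == cbeg (s a)] &
     [forall a, s (cinv a) == cinv (s a)]]].

Lemma gaut_group_set : group_set gaut.
Proof.
apply/group_setP; split.
  rewrite inE; apply/and4P; split; try by apply/forallP=> a; rewrite !perm1.
    by rewrite (eq_imset _ (@perm1 _)) imset_id.
  by rewrite (eq_imset _ (@perm1 _)) imset_id.
move=> s t; rewrite !inE.
case/and4P=> /eqP sV /eqP sD /forallP sb /forallP si.
case/and4P=> /eqP tV /eqP tD /forallP tb /forallP ti.
have E (A : {set cell X}) : (s * t) @: A = t @: (s @: A).
  by rewrite -imset_comp; apply: eq_imset => a; rewrite /= permM.
apply/and4P; split; rewrite ?E ?sV ?sD ?tV ?tD //.
  by apply/forallP=> a; rewrite !permM (eqP (sb a)) (eqP (tb _)).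
by apply/forallP=> a; rewrite !permM (eqP (si a)) (eqP (ti _)).
Qed.

Canonical gaut_group := Group gaut_group_set.

Definition half_arc_transitive (G : {group {perm cell X}}) : Prop :=
  [/\ [transitive G, on vertices | 'P], [transitive G, on edges | 'P^*]
    & ~~ [transitive G, on darts | 'P]].

End Graph.

Arguments gaut : clear implicits.

(* Main.v *)
(* The two G-orbits of darts each contribute two darts at every vertex, so G_v
   is a 2-group.  As N_v is nontrivial, N_v already moves the two darts of each
   pair; hence N G_v = N G_w for adjacent v and w, so K = N G_v is normal in G,
   with G / K cyclic and K / N a 2-group.  The normal subgroup N_v of the
   2-group G_v contains an involution r central in G_v, hence in K.  The
   normal closure E of r is an elementary abelian 2-group centralised by K, to
   which the same transitivity applies: g in G_v moves every dart d to d e for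
   some e in E, so g^2 moves d to d e^2 = d. *)
Require Import Defs.
From HB Require Import structures.
From mathcomp Require Import all_boot all_fingroup all_solvable.

Set Implicit Arguments.
Unset Strict Implicit.
Unset Printing Implicit Defensive.

Import GroupScope.

(** * Darts, edges and automorphisms of a connected tetravalent graph *)

Section Cells.

Variable X : dgraph.
Implicit Types (a d e : cell X) (s : {perm cell X}) (H : {group {perm cell X}}).

Lemma cinvK : involutive (@cinv X).
Proof. by case=> //= x; rewrite inv_involutive. Qed.

Lemma cinv_dart d : d \in darts X -> cinv d \in darts X.
Proof. by case/imsetP=> x _ ->; apply: imset_f. Qed.

Lemma cbeg_vertex a : cbeg a \in vertices X.
Proof. by case: a => ?; apply: imset_f. Qed.

Lemma mem_edge (x : dart X) a :
  (a \in edge x) = (a == dcell x) || (a == cinv (dcell x)).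
Proof.
apply/imsetP/orP => [[y] | [] /eqP->]; last 2 first.
- by exists x; rewrite // fingraph.in_orbit.
- by exists (Defs.inv x); rewrite // -fconnect_orbit fconnect1.
rewrite -fconnect_orbit => /iter_findex <- ->.
elim: (findex _ _ _) => [|n]; first by left.
by case=> /eqP[E]; [right | left]; rewrite iterS E ?inv_involutive.
Qed.

Lemma gaut_cbeg s a : s \in gaut X -> s (cbeg a) = cbeg (s a).
Proof. by rewrite inE => /and4P[_ _ /forallP/(_ a)/eqP]. Qed.

Lemma gaut_cinv s a : s \in gaut X -> s (cinv a) = cinv (s a).
Proof. by rewrite inE => /and4P[_ _ _ /forallP/(_ a)/eqP]. Qed.

Lemma gaut_dart s d : s \in gaut X -> d \in darts X -> s d \in darts X.
Proof.
by rewrite inE => /and4P[_ /eqP sD _ _] Dd; rewrite -sD imset_f.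
Qed.

Lemma astab_cbeg H d :
  H \subset gaut X -> 'C_H[d | 'P] \subset 'C_H[cbeg d | 'P].
Proof.
move=> sHA; apply/subsetP=> s /setIP[Hs /astab1P/= sd]; rewrite inE Hs.
by apply/astab1P; rewrite /= apermE gaut_cbeg ?(subsetP sHA) // -apermE sd.
Qed.

Lemma astab_cinv H d :
  H \subset gaut X -> 'C_H[cinv d | 'P] = 'C_H[d | 'P].
Proof.
move=> sHA; have sub e : 'C_H[e | 'P] \subset 'C_H[cinv e | 'P].
  apply/subsetP=> s /setIP[Hs /astab1P/= se]; rewrite inE Hs; apply/astab1P.
  by rewrite /= apermE gaut_cinv ?(subsetP sHA) // -apermE se.
by apply/eqP; rewrite eqEsubset sub -{2}(cinvK d) sub.
Qed.

Hypothesis X_connected : connected X.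

(** Induction along a path; connectedness enters the whole argument only through this principle. *)
Lemma vertex_propagation (P : cell X -> Prop) a :
  (forall d, d \in darts X -> P (cbeg d) -> P (cbeg (cinv d))) ->
  a \in vertices X -> P a -> forall b, b \in vertices X -> P b.
Proof.
move=> step /imsetP[u _ ->] Pu b /imsetP[v _ ->].
have /connectP[p] := X_connected u v.
elim: p u Pu => [|w p IHp] u Pu /= => [_ -> // | /andP[/existsP[x]]].
case/andP=> /eqP xu /eqP xw wp vE; apply: (IHp w) => //.
by rewrite -xw; apply: (step (dcell x)); rewrite ?imset_f //= xu.
Qed.

Hypothesis X_tetravalent : tetravalent X.

Lemma card_darts_at a :
  a \in vertices X -> #|[set d in darts X | cbeg d == a]| = 4.
Proof.
case/imsetP=> v _ ->; rewrite -(X_tetravalent v) /valence.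
rewrite -(card_imset _ (inr_inj : injective (@dcell X))); apply: eq_card => d.
rewrite !inE; apply/andP/imsetP => [[/imsetP[x _ ->]] | [x + ->]].
  by case/eqP=> xv; exists x; rewrite // inE xv.
by rewrite inE => /eqP <-; rewrite imset_f.
Qed.

Lemma dart_at a :
  a \in vertices X -> exists2 d, d \in darts X & cbeg d = a.
Proof.
move=> /card_darts_at Va.
have /card_gt0P[d] : 0 < #|[set d in darts X | cbeg d == a]|.
  by rewrite Va.
by rewrite inE => /andP[Dd /eqP]; exists d.
Qed.

(** Tetravalence puts a dart at every vertex, so the action on vertices is determined through [cbeg]
    by the action on darts. *)
Lemma gaut_faithful s :
  s \in gaut X -> (forall d, d \in darts X -> s d = d) -> s = 1.
Proof.
move=> As sD; apply/permP=> -[v|x]; rewrite perm1; last by rewrite sD ?imset_f.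
have [|d Dd dv] := @dart_at (vcell v); first exact: imset_f.
rewrite -/(vcell v) -dv.
by rewrite gaut_cbeg ?sD.
Qed.

End Cells.

(** * The two orbits of [G] on darts, and vertex stabilisers as 2-groups *)

Section HalfArcTransitive.

Variables (X : dgraph) (G : {group {perm cell X}}).
Hypotheses (X_connected : connected X) (X_tetravalent : tetravalent X).
Hypotheses (G_aut : G \subset gaut X) (G_half : half_arc_transitive G).
Implicit Types (a d e : cell X) (s t : {perm cell X}).

Let autG s : s \in G -> s \in gaut X. Proof. exact: (subsetP G_aut). Qed.

(** An element carrying the edge of [d] to that of [e] sends [d] to one of the darts [e], [cinv e].
    Hence [G] has at most two orbits on darts. *)
Lemma dart_orbit_cover d e : d \in darts X -> e \in darts X ->
  e \in orbit 'P G d \/ cinv e \in orbit 'P G d.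
Proof.
case: G_half => _ trE _ /imsetP[x _ ->] /imsetP[y _ ->].
have [||s Gs E] := atransP2 trE (x := edge x) (y := edge y); try exact: imset_f.
have: s (dcell x) \in edge y by rewrite E (mem_setact 'P) ?mem_edge ?eqxx.
rewrite mem_edge => /orP[]/eqP <-; [left | right]; exact: mem_orbit.
Qed.

(** If [G] could reverse [d], both cases of [dart_orbit_cover] would put every dart in the orbit of
    [d], against half-arc-transitivity. In particular there are no semiedges. *)
Lemma cinv_notin_orbit d : d \in darts X -> cinv d \notin orbit 'P G d.
Proof.
move=> Dd; apply/negP=> /orbitP[s Gs sd]; case: G_half => _ _ /negP[].
apply/imsetP; exists d => //; apply/setP=> e; apply/idP/idP=> [De|]; last first.
  by case/orbitP=> t Gt <-; apply: gaut_dart; first exact: autG.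
have [//|/orbitP[t Gt td]] := dart_orbit_cover Dd De.
apply/orbitP; exists (s * t); first exact: groupM.
rewrite actM sd /= apermE gaut_cinv ?autG // -apermE.
by rewrite (_ : aperm d t = cinv e) // cinvK.
Qed.

Lemma stab_orbitE d :
  orbit 'P 'C_G[cbeg d | 'P] d = [set e in orbit 'P G d | cbeg e == cbeg d].
Proof.
apply/setP=> e; rewrite inE; apply/orbitP/andP => [[s] | [/orbitP[s Gs sd] be]].
  case/setIP=> Gs /astab1P/= sb <-; split; first exact: mem_orbit.
  by rewrite /= apermE -gaut_cbeg ?autG // -apermE sb.
exists s => //; rewrite inE Gs; apply/astab1P.
by rewrite /= apermE gaut_cbeg ?autG // -apermE; move: sd => /= ->; apply/eqP.
Qed.

Lemma act_vertices s a : s \in G -> a \in vertices X -> s a \in vertices X.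
Proof.
move=> Gs Va; have [trV _ _] := G_half.
by rewrite -(atransP trV a Va); apply: (mem_orbit 'P).
Qed.

(* [e], a translate of the reverse of [d] to the same initial vertex, has a
   stabiliser conjugate to that of [d], so its orbit under the vertex
   stabiliser is as large; the two orbits partition the four darts there. *)
Lemma card_stab_orbit d :
  d \in darts X -> #|orbit 'P 'C_G[cbeg d | 'P] d| = 2.
Proof.
move=> Dd; have [trV _ _] := G_half.
have [s Gs sd] := atransP2 trV (cbeg_vertex (cinv d)) (cbeg_vertex d).
pose e := s (cinv d).
have be : cbeg e = cbeg d by rewrite sd /e -gaut_cbeg ?autG.
have De : e \in darts X by rewrite gaut_dart ?autG ?cinv_dart.
(* Fixing [f] entails fixing its initial vertex, so the orbit-stabiliser formula involves the full
   stabiliser of [f] in [G]. *)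
have cSt f : cbeg f = cbeg d ->
    (#|orbit 'P 'C_G[cbeg d | 'P] f| * #|'C_G[f | 'P]|)%N
      = #|'C_G[cbeg d | 'P]|.
  move=> bf; rewrite -(card_orbit_stab 'P 'C_G[cbeg d | 'P] f); congr (_ * _)%N.
  apply: eq_card => t; rewrite !in_setI -andbA; case Gt: (t \in G) => //=.
  apply/idP/andP=> [tf|[]//]; split=> //.
  have := subsetP (astab_cbeg f G_aut) t; rewrite !in_setI Gt bf tf.
  exact.
have eqC : #|'C_G[e | 'P]| = #|'C_G[d | 'P]|.
  rewrite -(astab_cinv d G_aut) -(cardJg 'C_G[cinv d | 'P] s) conjIg.
  by rewrite conjGid // -(astab1_act 'P (cinv d) s).
have eq2 : #|orbit 'P 'C_G[cbeg d | 'P] d| = #|orbit 'P 'C_G[cbeg d | 'P] e|.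
  apply/eqP; rewrite -(eqn_pmul2r (cardG_gt0 'C_G[d | 'P])) cSt //.
  by rewrite -eqC cSt.
have Oe : orbit 'P G e = orbit 'P G (cinv d).
  by apply/orbit_eqP; apply: (mem_orbit 'P).
have := card_darts_at X_tetravalent (cbeg_vertex d).
suff ->: [set f in darts X | cbeg f == cbeg d]
    = orbit 'P 'C_G[cbeg d | 'P] d :|: orbit 'P 'C_G[cbeg d | 'P] e.
  rewrite cardsU -eq2 (disjoint_setI0 (A := orbit _ _ d)).
    by rewrite cards0 subn0 addnn => /(congr1 half); rewrite doubleK.
  rewrite -{2}be !stab_orbitE disjoints_subset; apply/subsetP=> f.
  rewrite !inE => /andP[df _]; apply/nandP; left; apply/negP.
  rewrite Oe orbit_sym (orbit_eqP df); apply/negP; exact: cinv_notin_orbit.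
apply/setP=> f; rewrite -{3}be !stab_orbitE !inE be.
case: eqP => //; rewrite ?andbT ?andbF //= => _.
apply/idP/orP=> [Df | [|] /orbitP[t Gt <-]]; try by apply: gaut_dart => //; apply: autG.
have [|/orbitP[t Gt tf]] := dart_orbit_cover Dd Df; [by left | right].
rewrite Oe; apply/orbitP; exists t => //=.
by rewrite apermE gaut_cinv ?autG // -apermE; move: tf => /= ->; rewrite cinvK.
Qed.

(** By Cauchy it suffices to exclude elements of odd prime order. Such an element fixes all darts at
    any vertex it fixes, since their orbits have length at most 2; fixed vertices then spread along
    edges and it is trivial. *)
Lemma stab_pgroup a : a \in vertices X -> 2.-group 'C_G[a | 'P].
Proof.
move=> Va; apply/pgroupP=> p p_pr /(Cauchy p_pr)[s /setIP[Gs /astab1P/= sa] os].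
rewrite inE; apply/negPn/negP=> p2.
have fixD d : d \in darts X -> s (cbeg d) = cbeg d -> s d = d.
  move=> Dd sb; have sub : orbit 'P <[s]> d \subset orbit 'P 'C_G[cbeg d | 'P] d.
    by apply: imsetS; rewrite cycle_subG inE Gs; apply/astab1P.
  have := dvdn_orbit 'P <[s]> d; rewrite -orderE os.
  case/primeP: (p_pr) => _ pdiv /pdiv /orP[/eqP/card_orbit1 | /eqP op].
    move/setP/(_ (s d)); rewrite inE => E; apply/eqP; rewrite -E.
    exact/(mem_orbit 'P)/cycle_id.
  have := subset_leq_card sub; rewrite op card_stab_orbit // leqNgt.
  by rewrite ltn_neqAle eq_sym p2 prime_gt1.
have fixV : forall b, b \in vertices X -> s b = b.
  apply: (vertex_propagation X_connected _ Va) => // d Dd /fixD sd.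
  by rewrite gaut_cbeg ?gaut_cinv ?sd ?autG.
have s1 : s = 1.
  apply: gaut_faithful => // [|d Dd]; first exact: autG.
  by rewrite fixD ?fixV ?cbeg_vertex.
by move: p_pr; rewrite -os s1 order1.
Qed.

(** For [H] inside [G], this says that at each vertex the stabilisers in [H] and in [G] have the
    same orbits on darts. *)
Definition locally_transitive (H : {set {perm cell X}}) :=
  forall d s, d \in darts X -> s \in 'C_G[cbeg d | 'P] ->
  exists2 t, t \in 'C_H[cbeg d | 'P] & t d = s d.

(** * Normal subgroups that are locally transitive *)

Section NormalSubgroup.

Variable N : {group {perm cell X}}.
Hypothesis nsNG : N <| G.

Lemma astab_normalJ a s : s \in G -> 'C_N[s a | 'P] = 'C_N[a | 'P] :^ s.
Proof.
move=> Gs; rewrite conjIg (normsP (normal_norm nsNG)) //.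
by rewrite -(astab1_act 'P a s).
Qed.

(* Otherwise [N] fixes a dart [d] along with its initial vertex, and then so
   for all darts in the orbit of [d]: the stabilisers in [N] of the ends of an
   edge coincide, hence all of them do, and they fix every dart. *)
Lemma normal_locally_transitive a :
  a \in vertices X -> 'C_N[a | 'P] != 1 -> locally_transitive N.
Proof.
move=> Va ntNa d s Dd Cs; have [sNG nNG] := andP nsNG.
have [trV _ _] := G_half.
have sNA : N \subset gaut X := subset_trans sNG G_aut.
have sub : orbit 'P 'C_N[cbeg d | 'P] d \subset orbit 'P 'C_G[cbeg d | 'P] d.
  by apply: imsetS; apply: setSI.
have [small | big] := leqP #|orbit 'P 'C_N[cbeg d | 'P] d| 1; last first.
  have E : orbit 'P 'C_N[cbeg d | 'P] d = orbit 'P 'C_G[cbeg d | 'P] d.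
    by apply/eqP; rewrite eqEcard sub card_stab_orbit.
  have: s d \in orbit 'P 'C_G[cbeg d | 'P] d by apply: (mem_orbit 'P).
  by rewrite -E => /orbitP[t Nt td]; exists t.
case/negP: ntNa; apply/eqP.
have fixd : 'C_N[cbeg d | 'P] \subset 'C_N[d | 'P].
  rewrite subsetI subsetIl /=; apply/subsetP=> t Nt; apply/astab1P.
  have/card_orbit1/setP/(_ ('P%act d t)) : #|orbit 'P 'C_N[cbeg d | 'P] d| = 1%N.
    by apply/eqP; rewrite eqn_leq small (cardD1 d) orbit_refl.
  by rewrite mem_orbit // inE => /esym/eqP.
have fixO e : e \in orbit 'P G d -> 'C_N[cbeg e | 'P] = 'C_N[e | 'P].
  case/orbitP=> t Gt <-; rewrite /= apermE -gaut_cbeg ?autG // !astab_normalJ //.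
  by congr (_ :^ _); apply/eqP; rewrite eqEsubset fixd astab_cbeg.
(* These stabilisers are conjugate under [G]; their equal orders turn the inclusion along an edge
   into an equality. *)
have cardV b c : b \in vertices X -> c \in vertices X ->
    #|'C_N[b | 'P]| = #|'C_N[c | 'P]|.
  move=> Vb Vc; have [t Gt ->] := atransP2 trV Vb Vc.
  by rewrite /= apermE astab_normalJ // cardJg.
have eqO e : e \in orbit 'P G d ->
    'C_N[cbeg e | 'P] = 'C_N[cbeg (cinv e) | 'P].
  move=> Oe; apply/eqP; rewrite eqEcard (cardV _ _ _ (cbeg_vertex (cinv e))).
    by rewrite leqnn andbT fixO // -astab_cinv // astab_cbeg.
  exact: cbeg_vertex.
have eqV b : b \in vertices X -> 'C_N[a | 'P] = 'C_N[b | 'P].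
  apply: (vertex_propagation X_connected (P := fun b => 'C_N[a | 'P] = 'C_N[b | 'P]) _ Va) => // e De ->.
  by have [/eqO // | /eqO] := dart_orbit_cover Dd De; rewrite cinvK.
apply/trivgP/subsetP=> t Nt; apply/set1P; have Gt : t \in G.
  by case/setIP: Nt => /(subsetP sNG).
apply: gaut_faithful => // [|e De]; first exact: autG.
have fixe f : f \in orbit 'P G d -> t f = f.
  move=> Of; move: Nt; rewrite /= (eqV _ (cbeg_vertex f)) fixO //.
  by case/setIP=> _ /astab1P.
have [/fixe // | /fixe] := dart_orbit_cover Dd De.
by rewrite gaut_cinv ?autG // => /(can_inj (@cinvK X)).
Qed.

Hypothesis trN : locally_transitive N.

(** A Frattini argument: if [t] in [N] moves [d] as [s] does, then [s * t^-1] fixes [d]. *)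
Lemma stab_sub_joing d : d \in darts X ->
  'C_G[cbeg d | 'P] \subset N <*> 'C_G[d | 'P].
Proof.
move=> Dd; apply/subsetP=> s Cs; have [t Nt td] := trN Dd Cs.
case/setIP: Nt => Nt _; case/setIP: Cs => Gs _.
have Gt : t \in G := subsetP (normal_sub nsNG) t Nt.
rewrite -(mulgKV t s) groupM //; last by rewrite mem_gen // inE Nt.
rewrite mem_gen // inE; apply/orP; right; rewrite inE groupM ?groupV //=.
by apply/astab1P; rewrite /= apermE permM -td permK.
Qed.

(** By the Frattini argument the vertex stabiliser can be replaced by that of a dart there, and a
    dart and its reverse have the same stabiliser. *)
Lemma joing_stab_const a b : a \in vertices X -> b \in vertices X ->
  N <*> 'C_G[a | 'P] = N <*> 'C_G[b | 'P].
Proof.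
move=> Va; apply: (vertex_propagation X_connected
  (P := fun b => N <*> 'C_G[a | 'P] = N <*> 'C_G[b | 'P]) _ Va) => // d Dd ->.
have eqd e : e \in darts X -> N <*> 'C_G[cbeg e | 'P] = N <*> 'C_G[e | 'P].
  move=> De; apply/eqP; rewrite eqEsubset !join_subG !joing_subl.
  by rewrite stab_sub_joing //= (subset_trans (astab_cbeg e G_aut)) ?joing_subr.
by rewrite !eqd ?cinv_dart // astab_cinv.
Qed.

Lemma joing_stab_normal a :
  a \in vertices X -> N <*> 'C_G[a | 'P] <| G.
Proof.
move=> Va; rewrite /normal join_subG (normal_sub nsNG) /= subsetIl /=.
apply/normsP=> s Gs; rewrite conjYg (normsP (normal_norm nsNG)) //.
rewrite conjIg conjGid // -(astab1_act 'P a s).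
by apply: joing_stab_const => //; apply: act_vertices.
Qed.

(* Translating an edge at [a] along itself shifts all of [V / N], because
   [N] permutes the darts of either orientation at [a] transitively. *)
Lemma normal_cyclic_extension a : a \in vertices X ->
  exists2 s, s \in G & G :=: (N <*> 'C_G[a | 'P]) <*> <[s]>.
Proof.
move=> Va; have [d Dd da] := dart_at X_tetravalent Va; have [trV _ _] := G_half.
have [s Gs sd] := atransP2 trV (cbeg_vertex d) (cbeg_vertex (cinv d)).
exists s => //; set H := _ <*> <[s]>.
have sHG : H \subset G.
  by rewrite !join_subG (normal_sub nsNG) /= subsetIl cycle_subG.
have Hs : s \in H by rewrite mem_gen // inE cycle_id orbT.
have sCH : 'C_G[a | 'P] \subset H.
  by apply: subset_trans (joing_subl _ _); apply: joing_subr.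
have sNH : N \subset H.
  by apply: subset_trans (joing_subl _ _); apply: joing_subl.
apply/eqP; rewrite eqEsubset sHG andbT.
have step e : e \in darts X -> cbeg e = a -> cbeg (cinv e) \in orbit 'P H a.
  move=> De ea.
  (* From a reference dart [f] whose far end is reached by [r], some [u] in [N] moves [f] to [e], so
     [r * u] reaches the far end of [e]. *)
  have key f r : f \in darts X -> cbeg f = a -> e \in orbit 'P G f ->
      r \in H -> r a = cbeg (cinv f) -> cbeg (cinv e) \in orbit 'P H a.
    move=> Df fa ef Hr ra.
    have : e \in orbit 'P 'C_G[cbeg f | 'P] f by rewrite stab_orbitE // inE ef ea fa /=.
    case/orbitP=> t Ct te; have [u Nu uf] := trN Df Ct.
    case/setIP: Nu => Nu _; have Hu : u \in H := subsetP sNH u Nu.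
    apply/orbitP; exists (r * u); first exact: groupM.
    have Au : u \in gaut X by apply/autG/(subsetP sHG).
    by rewrite actM /= !apermE ra gaut_cbeg // gaut_cinv // uf; congr (cbeg (cinv _)).
  have [ed | ed] := dart_orbit_cover Dd De.
    by apply: (key d s); rewrite // -da.
  (* For the other orientation the reference dart is [cinv d] pulled back by [s] to start at [a]. *)
  have sf : s^-1 (cbeg (cinv d)) = a by rewrite sd da /= apermE permK.
  have AsV : s^-1 \in gaut X by rewrite groupV autG.
  apply: (key (s^-1 (cinv d)) s^-1); rewrite ?groupV //.
  - by rewrite gaut_dart ?cinv_dart.
  - by rewrite -gaut_cbeg.
  - case/orbitP: ed => t Gt td; apply/orbitP; exists (s * t); first exact: groupM.
    rewrite actM /= !apermE permKV gaut_cinv ?autG //.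
    by move: td; rewrite /= apermE => ->; rewrite cinvK.
  by rewrite -gaut_cinv // -gaut_cbeg // cinvK da.
have orbV b : b \in vertices X -> b \in orbit 'P H a.
  apply: (vertex_propagation X_connected (P := fun b => b \in orbit 'P H a) _ Va); last exact: orbit_refl.
  move=> e De /orbitP[t Ht te]; have At : t^-1 \in gaut X by rewrite groupV autG ?(subsetP sHG).
  have : cbeg (cinv (t^-1 e)) \in orbit 'P H a.
    apply: step; first exact: gaut_dart.
    by rewrite -gaut_cbeg // -te /= apermE permK.
  by rewrite -gaut_cinv // -gaut_cbeg // (orbit_actr 'P) // groupV.
apply/subsetP=> t Gt.
have /orbitP[u Hu] := orbV _ (act_vertices Gt Va); rewrite /= apermE => ua.
rewrite -(mulgKV u t) groupM // (subsetP sCH) // inE groupM ?groupV //=; last exact: (subsetP sHG).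
by apply/astab1P; rewrite /= apermE permM -ua permK.
Qed.

(* Every element of a vertex stabiliser moves each dart the way some element
   of [N] does. *)
Lemma stab_exponent2 a : a \in vertices X ->
  2.-abelem N -> N \subset 'C('C_G[a | 'P]) ->
  forall s, s \in 'C_G[a | 'P] -> s ^+ 2 = 1.
Proof.
move=> Va /(abelemP (isT : prime 2))[_ N2] cNC s Cs.
have [Gs sa] := setIP Cs; have As := autG Gs.
have cs t : t \in N -> t * s = s * t.
  by move=> Nt; apply/(centP (subsetP cNC t Nt)).
have sNA : N \subset gaut X := subset_trans (normal_sub nsNG) G_aut.
pose P b := exists2 t, t \in N & s b = t b.
have dstep d : d \in darts X -> P (cbeg d) -> P d.
  move=> Dd [t Nt td]; have Gt := subsetP (normal_sub nsNG) t Nt.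
  (* Once [t] corrects the initial vertex, local transitivity gives [u] in [N] imitating [s * t^-1]
     on [d]; then [u * t] imitates [s]. *)
  have Cst : s * t^-1 \in 'C_G[cbeg d | 'P].
    rewrite inE groupM ?groupV //=; apply/astab1P.
    by rewrite /= apermE permM td permK.
  have [u /setIP[Nu _] ud] := trN Dd Cst.
  by exists (u * t); rewrite ?groupM // permM ud permM permKV.
have PV : forall b, b \in vertices X -> P b.
  apply: (vertex_propagation X_connected _ Va) => // [d Dd /(dstep _ Dd)[t Nt td] | ].
    have At := subsetP sNA t Nt.
    by exists t; rewrite // !gaut_cbeg // !gaut_cinv // td.
  by exists 1; rewrite ?perm1 //; move/astab1P: sa.
apply: gaut_faithful => // [|d Dd]; first by rewrite groupX.
have [t Nt td] := dstep d Dd (PV _ (cbeg_vertex d)).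
by rewrite expgS expg1 permM td -permM cs // permM td -permM -expg2 N2 ?perm1.
Qed.

End NormalSubgroup.

End HalfArcTransitive.

(** * Solvability of [G], then the normal closure of a central involution *)

Theorem theorem3p1 (X : dgraph) (G N : {group {perm cell X}})
  (X_connected : connected X) (X_tetravalent : tetravalent X)
  (G_aut : G \subset gaut X) (G_half : half_arc_transitive G)
  (N_normal : N <| G) (N_abelian : abelian N)
  (N_stab : exists v : vertex X, 'C_N[vcell v | 'P] != 1) :
  solvable G /\ forall v : vertex X, is_abelem 'C_G[vcell v | 'P].
Proof.
have [v ntNv] := N_stab; pose a := vcell v.
have Va : a \in vertices X by apply: imset_f.
have [sNG nNG] := andP N_normal.
have trN := normal_locally_transitive X_connected X_tetravalent G_aut G_half
  N_normal Va ntNv.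
have pC b (Vb : b \in vertices X) :=
  stab_pgroup X_connected X_tetravalent G_aut G_half Vb.
have nsKG := joing_stab_normal X_connected G_aut G_half N_normal trN Va.
have [s Gs defG] := normal_cyclic_extension X_connected X_tetravalent G_aut
  G_half N_normal trN Va.
pose K := (N <*> 'C_G[a | 'P])%G.
have nNC : 'C_G[a | 'P] \subset 'N(N) by rewrite subIset ?nNG.
split.
  rewrite (series_sol nsKG) /= (series_sol (G := K) (H := N)); last first.
    by rewrite /normal joing_subl join_subG normG.
  rewrite abelian_sol //= quotientYidl // quotient_sol ?(pgroup_sol (pC a Va)) //=.
  have nKs : <[s]> \subset 'N(K) by rewrite cycle_subG (subsetP (normal_norm nsKG)).
  have -> : G / K = <[s]> / K by rewrite {1}defG quotientYidl.
  by rewrite abelian_sol // quotient_abelian // cycle_abelian.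
have [r /setIP[/setIP[Nr ra] /setIP[Cr cCr]] or2] :
    {r | r \in 'C_N[a | 'P] :&: 'Z('C_G[a | 'P]) & #[r] = 2}.
  have nt : 'C_N[a | 'P] :&: 'Z('C_G[a | 'P]) != 1.
    apply: meet_center_nil => //; first exact: pgroup_nil (pC a Va).
    rewrite /normal setSI //=; apply/normsP=> t /setIP[Gt ta].
    by rewrite conjIg (normsP nNG) // conjGid.
  apply: Cauchy => //.
  have sC : 'C_N[a | 'P] :&: 'Z('C_G[a | 'P]) \subset 'C_G[a | 'P].
    by rewrite subIset // setSI.
  by have [_ ? _] := pgroup_pdiv (pgroupS sC (pC a Va)) nt.
have cKr : r \in 'C(K).
  by rewrite /= centY inE cCr (subsetP N_abelian).
pose E := <<r ^: G>>%G.
have sEN : E \subset N by rewrite gen_subG class_sub_norm.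
(* The centraliser of the normal subgroup [K] is normalised by [G], so it contains every conjugate
   of [r]. *)
have cKE : E \subset 'C(K).
  by rewrite gen_subG class_sub_norm // norms_cent ?normal_norm.
have nsEG : E <| G.
  by rewrite /normal (subset_trans sEN) // norms_gen ?class_norm.
have Er : r \in E by rewrite mem_gen ?class_refl.
have abE : 2.-abelem E.
  rewrite abelemE // (abelianS sEN) //= abelian_exponent_gen; last first.
    by rewrite -abelian_gen (abelianS sEN).
  by apply/exponentP=> _ /imsetP[t Gt ->]; rewrite -conjXg -or2 expg_order conj1g.
have trE : locally_transitive G E.
  apply: (normal_locally_transitive X_connected X_tetravalent G_aut G_half nsEG Va).
  by apply/trivgPn; exists r; [rewrite inE Er | rewrite -order_eq1 or2].
move=> w; have Vw : vcell w \in vertices X by apply: imset_f.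
(* [K] is the same group when formed at [w], so [E] centralises the stabiliser of [w] too. *)
have defK := joing_stab_const X_connected G_aut N_normal trN Va Vw.
apply/is_abelemP; exists 2 => //; apply: exponent2_abelem; apply/exponentP.
apply: (stab_exponent2 X_connected X_tetravalent G_aut nsEG trE Vw abE).
by rewrite (subset_trans cKE) // centS //= defK joing_subr.
Qed.
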